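(* Let $P,Q\in\mathbb{Z}^{2\times 2}$ be invertible (over $\mathbb{Q}$) matrices of the form $$P=\begin{bmatrix} a & b\\ \varepsilon & d\end{bmatrix},\qquad Q=\begin{bmatrix} r & s\\ 0&\delta\end{bmatrix},$$ where $a,b,d,r,s\in\mathbb{Z}$, $r>0$, and $\varepsilon,\delta\in\{1,-1\}$, and suppose that $\det P$ and $\det Q$ are coprime integers. Let $p=|\det P|$ and $\mathcal{D}=\{(0,0)^\top,(1,0)^\top,\dots,(p-1,0)^\top\}$. Suppose that $Q^{-1}P$ is expanding, let $\chi(x)=x^2+\alpha x+\beta$ be the characteristic polynomial of $Q^{-1}P$ (so $\alpha,\beta\in\mathbb{Q}$), and let $\mathcal{A}$ be the attractor of the digit system $(P,Q,\mathcal{D})$. 1. If $0\le\alpha\le\beta-1$, then $\mathcal{A}=\{(0,0)^\top\}$. 2. If $1<-\alpha\le\beta-1$, then $\mathcal{A}=\{\ell\,(1-\tfrac{d}{\delta},\tfrac{\varepsilon}{\delta})^\top : \ell=0,1,\dots,K\}$, where $K$ is the largest nonnegative integer such that $K(p+r\alpha+r)\le p-1$. 3. If $0<-\alpha\le 1$ and $-\alpha\le\beta-1$, then $\mathcal{A}=\{(0,0)^\top\}$. 4. If $0<-\alpha\le-\beta-1$, then $\mathcal{A}$ contains the set $\{(0,0)^\top,(-1,0)^\top,(\tfrac{d}{\delta},-\tfrac{\varepsilon}{\delta})^\top\}$. 5. If $0<\alpha\le-\beta-1$, then $\mathcal{A}$ contains the set $\{-\ell\,(1-\tfrac{d}{\delta},\tfrac{\varepsilon}{\delta})^\top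 : \ell=0,1,\dots,K\}$, where $K$ is the largest nonnegative integer such that $K(p-r\alpha-r)\le p-1$.
   Context: A square matrix is expanding if all of its (complex) eigenvalues have modulus greater than $1$. For $A\in\mathbb{Q}^{2\times2}$ invertible, $\mathbb{Z}^2[A]=\bigcup_{k\ge1}(\mathbb{Z}^2+A\mathbb{Z}^2+\cdots+A^{k-1}\mathbb{Z}^2)\subseteq\mathbb{Q}^2$. Under the hypotheses, $\mathcal{D}$ is a complete residue system (exactly one representative of each coset) both of $\mathbb{Z}^2/P\mathbb{Z}^2$ and of the quotient group $(\mathbb{Z}^2+P\mathbb{Z}^2[Q^{-1}P])/P\mathbb{Z}^2[Q^{-1}P]$. For $v\in\mathbb{Z}^2+P\mathbb{Z}^2[Q^{-1}P]$ let $\mathbf{d}(v)\in\mathcal{D}$ be the unique digit with $v-\mathbf{d}(v)\in P\mathbb{Z}^2[Q^{-1}P]$. The dynamical system associated with $(P,Q,\mathcal{D})$ is $\Phi:\mathbb{Z}^2[Q^{-1}P]\to\mathbb{Z}^2[Q^{-1}P]$, $\Phi(x)=P^{-1}(Qx-\mathbf{d}(Qx))$. The attractor of the digit system $(P,Q,\mathcal{D})$ is the attractor of $\Phi$, i.e. the set $\mathcal{A}\subseteq\mathbb{Z}^2[Q^{-1}P]$ such that (i) $\Phi(\mathcal{A})\subseteq\mathcal{A}$; (ii) for every $x\in\mathbb{Z}^2[Q^{-1}P]$ there is $n\in\mathbb{N}$ with $\Phi^n(x)\in\mathcal{A}$; (iii) no proper subset of $\mathcal{A}$ satisfies (i) and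 (ii). It is unique if it exists, and it exists and is finite when $Q^{-1}P$ is expanding. *)

(* Defs.v *)
From HB Require Import structures.
From mathcomp Require Import all_boot all_order all_algebra all_field.
From mathcomp Require Import boolp classical_sets.

Set Implicit Arguments.
Unset Strict Implicit.
Unset Printing Implicit Defensive.

Import Order.TTheory GRing.Theory Num.Theory.

Local Open Scope classical_set_scope.
Local Open Scope ring_scope.

Definition mx2 {R : Type} (a b c d : R) : 'M[R]_2 :=
  \matrix_(i < 2, j < 2)
    if i == ord0 then (if j == ord0 then a else b)
    else (if j == ord0 then c else d).

Definition cv2 {R : Type} (x y : R) : 'cV[R]_2 :=
  \col_(i < 2) if i == ord0 then x else y.

Definition ratmx {m n : nat} (M : 'M[int]_(m, n)) : 'M[rat]_(m, n) :=
  map_mx intr M.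

(* The complex eigenvalues of a rational matrix are algebraic, so they all lie
   in algC. *)
Definition expanding {n : nat} (A : 'M[rat]_n) : Prop :=
  forall z : algC, eigenvalue (map_mx ratr A : 'M[algC]_n) z -> 1 < `|z|.

Definition Z2adj (A : 'M[rat]_2) : set 'cV[rat]_2 :=
  \bigcup_(k in [set k : nat | (1 <= k)%N])
    [set \sum_(i < k) A ^+ i *m ratmx (u i) | u in [set: 'I_k -> 'cV[int]_2]].

Section DigitSystem.
Variables (P Q : 'M[int]_2) (D : set 'cV[int]_2).

Definition digit_module : set 'cV[rat]_2 := Z2adj (invmx (ratmx Q) *m ratmx P).

(* The default value 0 is only returned when no digit is congruent to v; this
   does not happen when D is a complete residue system, and the digit is then
   unique. *)
Definition digit (v : 'cV[rat]_2) : 'cV[int]_2 :=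
  xget 0 [set e | D e /\
    [set ratmx P *m y | y in digit_module] (v - ratmx e)].

Definition digit_map (x : 'cV[rat]_2) : 'cV[rat]_2 :=
  invmx (ratmx P) *m (ratmx Q *m x - ratmx (digit (ratmx Q *m x))).

End DigitSystem.

Definition absorbing {T : Type} (X : set T) (f : T -> T) (A : set T) : Prop :=
  f @` A `<=` A /\ forall x, X x -> exists n : nat, A (iter n f x).

(* The map f is total on T, but only its restriction to X is meant: f is
   expected to send X to itself. *)
Definition is_attractor {T : Type} (X : set T) (f : T -> T) (A : set T) : Prop :=
  [/\ A `<=` X, absorbing X f A & forall B, B `<` A -> ~ absorbing X f B].

Definition digit_attractor (P Q : 'M[int]_2) (D : set 'cV[int]_2)
    (A : set 'cV[rat]_2) : Prop :=
  is_attractor (digit_module P Q) (digit_map P Q D) A.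

Definition collinear_digits (p : nat) : set 'cV[int]_2 :=
  [set cv2 k%:Z 0 | k in [set k : nat | (k < p)%N]].

Definition is_largest_nat (S : set nat) (K : nat) : Prop :=
  S K /\ forall m : nat, S m -> (m <= K)%N.

(* Main.v *)
(* In the basis [e1 = (1, 0)], [f = (d / del, - eps / del)] of [Z^2] the map
   [Phi] sends [u e1 + v f] to [- v e1 + v' f], where the digit is
   [r u - m v - n v'] with the integers [m = r alpha] and [n = r beta = +- p].
   Thus the integer orbits are the integer sequences [z] with
   [0 <= - (n z_(i+2) + m z_(i+1) + r z_i) < p].  Every orbit of the digit
   module enters [Z^2], since one step shortens a representation
   [\sum_(i < k) A ^+ i u_i] by one term; digits are unique because the
   denominators of the module are coprime to [\det P].
   In cases 1-3, [n = p] and [|m| + r <= p], so [z] is bounded; comparing its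
   limits superior and inferior shows that [z] is eventually constant.  In cases
   4 and 5 the listed points are periodic, and an attractor contains every
   periodic point. *)
Require Import Defs.
From HB Require Import structures.
From mathcomp Require Import all_boot all_order all_algebra all_field.
From mathcomp Require Import boolp classical_sets.
From mathcomp Require Import zify ring lra.

Set Implicit Arguments.
Unset Strict Implicit.
Unset Printing Implicit Defensive.

Import Order.TTheory GRing.Theory Num.Theory.

Local Open Scope classical_set_scope.
Local Open Scope ring_scope.

(** * Bounded integer sequences and the floor recurrence *)

(** A finite limit superior of integers is attained, hence this encoding; the recurrence is later
    read at the indices where the value occurs. *)
Definition is_limsup (z : nat -> int) (M : int) : Prop :=
  (exists n0, forall i, (n0 <= i)%N -> z i <= M) /\
  (forall n, exists2 i, (n <= i)%N & z i = M).

Lemma bounded_limsup (z : nat -> int) (B : int) :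
  (forall i, `|z i| <= B) -> exists M, is_limsup z M.
Proof.
move=> zB.
have [k] : exists k : nat, B < - B + k%:Z.
  by exists (`|B| + `|B| + 1)%N; lia.
have : exists n0, forall i, (n0 <= i)%N -> z i <= B.
  by exists 0%N => i _; have := zB i; lia.
(* Only the eventual upper bound is generalized, to [M]; the lower bound [- B] stays. If [M] is
   attained only finitely often, [M - 1] is an eventual bound too, and [k] limits the number of
   descents. *)
elim: k {1 2}B => [|k IHk] M [n0 zM] BM.
  by have := zM n0 (leqnn _); have := zB n0; lia.
have [often|/existsNP[n rare]] :=
  pselect (forall n, exists2 i, (n <= i)%N & z i = M).
  by exists M; split=> //; exists n0.
apply: (IHk (M - 1)); last by lia.
exists (maxn n0 n) => i; rewrite geq_max => /andP[n0i ni].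
have : z i <> M by move=> ziM; apply: rare; exists i.
by have := zM i n0i; lia.
Qed.

Section FloorRecurrence.
Variables (p m r : int) (z : nat -> int).
Hypotheses (r_gt0 : 0 < r) (mr_le : `|m| + r <= p).
Hypothesis zP : forall i, 0 <= - (p * z i.+2 + m * z i.+1 + r * z i) < p.

(** The larger of the first two absolute values persists: if it bounds two consecutive terms, the
    next one has absolute value below [B + 1], hence at most [B] by integrality. *)
Lemma floor_recurrence_bounded : exists B, forall i, `|z i| <= B.
Proof.
exists (Num.max `|z 0%N| `|z 1%N|) => i.
set B := Num.max _ _.
suff: `|z i| <= B /\ `|z i.+1| <= B by case.
elim: i => [|i [zi zi1]]; first by rewrite /B !le_max !lexx orbT.
split=> //; have := zP i => /andP[lo hi].
have H1 : `|m * z i.+1| <= `|m| * B by rewrite normrM ler_wpM2l.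
have H2 : `|r * z i| <= r * B by rewrite normrM gtr0_norm // ler_wpM2l // ltW.
have H3 : (`|m| + r) * B <= p * B by apply: ler_wpM2r => //; lia.
have : p * z i.+2 < p * (B + 1) by lia.
have : p * - z i.+2 < p * (B + 1) by lia.
rewrite !ltr_pM2l; lia.
Qed.

Lemma floor_recurrence_limits : exists M N, is_limsup z M /\ is_limsup (\- z) N.
Proof.
have [B zB] := floor_recurrence_bounded.
have [M zM] := bounded_limsup zB.
have [|N zN] := @bounded_limsup (\- z) B; first by move=> i; rewrite normrN.
by exists M, N.
Qed.

(** Late terms lie in [[- N, M]]. Reading the recurrence where an extreme value occurs bounds [M]
    and [N] by each other; for [M <= 0] this gives [N <= 0], and only 0 remains. *)
Lemma floor_recurrence_vanish :
  0 <= m -> r < p -> exists n, forall i, (n <= i)%N -> z i = 0.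
Proof.
move=> m_ge0 rp.
have [M [N [[[n1 zM] ofM] [[n2 zN] ofN]]]] := floor_recurrence_limits.
pose n0 := maxn n1 n2.
have zMN i : (n0 <= i)%N -> - N <= z i <= M.
  rewrite geq_max => /andP[/zM zi /zN /=]; lia.
have NM : - N <= M by have := zMN _ (leqnn n0); lia.
have pM : p * M <= (m + r) * N.
  have [[|[|i]]] := ofM n0.+2; rewrite ?ltnS // => n0i ziM.
  by have := zP i; have := zMN _ n0i; have := zMN _ (leqW n0i); nia.
have pN : p * N <= (m + r) * M + p - 1.
  have [[|[|i]]] := ofN n0.+2; rewrite ?ltnS // => n0i /= ziN.
  by have := zP i; have := zMN _ n0i; have := zMN _ (leqW n0i); nia.
have [M_le0|M_gt0] := leP M 0.
  have N_le0 : N <= 0 by nia.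
  by exists n0 => i /zMN; lia.
(* If [M > 0] then [N = M] and [m + r = p]; the extreme values then force the
   impossible pattern [- M, M, - M, - M, M]. *)
exfalso.
have NeM : N = M by nia.
have mrp : m + r = p by nia.
have m_gt0 : 0 < m by lia.
have [[|[|[|[|[|i]]]]]] := ofM (n0 + 5)%N; rewrite ?addnS ?addn0 ?ltnS // => n0i z5.
have b0 := zMN _ n0i.
have b1 := zMN _ (leqW n0i).
have b2 := zMN _ (leqW (leqW n0i)).
have b3 := zMN _ (leqW (leqW (leqW n0i))).
have b4 := zMN _ (leqW (leqW (leqW (leqW n0i)))).
have := zP i; have := zP i.+1; have := zP i.+2; have := zP i.+3.
subst N.
move: b0 b1 b2 b3 b4 z5.
move: (z i) (z i.+1) (z i.+2) (z i.+3) (z i.+4) (z i.+4.+1).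
move=> z0 z1 z2 z3 z4 z5 b0 b1 b2 b3 b4 z5M h3 h2 h1 h0.
have z4E : z4 = - M by nia.
have z3E : z3 = - M by nia.
subst z5 z4 z3.
(* The digit that produces [z4] is at most [p - 1]; the resulting bound exceeds [r * (M - 1)], which
   leaves only [z2 = M]. *)
have rz2 : (M - 1) * p + m * M + 1 <= r * z2 by nia.
have z2E : z2 = M by nia.
have z1E : z1 = - M by subst z2; nia.
(* The digits that produce [z3] and [z4] are now [2 * r * M] and [2 * m * M]; they sum to
   [2 * p * M], yet each is below [p]. *)
by subst z2 z1; nia.
Qed.

(** For [N <= 0] the late terms vanish. Otherwise [- N] propagates backwards from arbitrarily late
    indices to all late ones, and the recurrence on a constant sequence bounds [l]. *)
Lemma floor_recurrence_constant :
  m < 0 -> exists n l, (0 <= l /\ l * (p + m + r) < p) /\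
    forall i, (n <= i)%N -> z i = - l.
Proof.
move=> m_lt0.
have [M [N [[[n1 zM] ofM] [[n2 zN] ofN]]]] := floor_recurrence_limits.
pose n0 := maxn n1 n2.
have zMN i : (n0 <= i)%N -> - N <= z i <= M.
  rewrite geq_max => /andP[/zM zi /zN /=]; lia.
have NM : - N <= M by have := zMN _ (leqnn n0); lia.
have pM : p * M <= - m * M + r * N.
  have [[|[|i]]] := ofM n0.+2; rewrite ?ltnS // => n0i ziM.
  by have := zP i; have := zMN _ n0i; have := zMN _ (leqW n0i); nia.
have M_le0 : N <= 0 -> M <= 0 by nia.
have [N_le0|N_gt0] := leP N 0.
  exists n0, 0; split; first by nia.
  by move=> i /zMN; have := M_le0 N_le0; lia.
have MleN : M <= N by nia.
(* Unless [M = N] and [p + m = r], a value [- N] must be preceded by [- N]. *)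
have stepN i : (n0 <= i)%N -> z i.+2 = - N -> z i.+1 = - N \/
    (z i = N /\ M = N /\ p + m = r).
  move=> n0i z2; have := zP i; have := zMN _ n0i; have := zMN _ (leqW n0i).
  rewrite {}z2; move: (z i) (z i.+1) => z0 z1 b1 b0 h.
  have [->|z1N] := eqVneq z1 (- N); [by left|right].
  have z0N : z0 = N by nia.
  have MN : M = N by lia.
  by nia.
(* In the exceptional case a late [M] forces the two terms before it to be [- N, M]. This earlier
   [M] would likewise have to be preceded by [M], a contradiction. *)
have [[MN pmr]|notMN] := pselect (M = N /\ p + m = r).
  exfalso; have [[|[|[|i]]]] := ofM (n0 + 3)%N; rewrite ?addnS ?addn0 ?ltnS // => n0i.
  have := zP i; have := zP i.+1.
  have := zMN _ n0i; have := zMN _ (leqW n0i); have := zMN _ (leqW (leqW n0i)).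
  move: (z i) (z i.+1) (z i.+2) (z i.+3) => z0 z1 z2 z3 b2 b1 b0 h1 h0 z3M.
  have z1N : z1 = - N by nia.
  have z2M : z2 = M by nia.
  by subst z1 z2; nia.
have back i k : (n0 <= i)%N -> z (i + k).+1 = - N -> z i.+1 = - N.
  move=> n0i; elim: k => [|k IHk]; first by rewrite addn0.
  rewrite addnS => /stepN[|/IHk //|[_ /notMN //]].
  exact: leq_trans (leq_addr _ _).
have zcst i : (n0 <= i)%N -> z i.+1 = - N.
  move=> n0i; have [[//|j]] := ofN i.+1; rewrite ltnS => ij /= zj.
  by apply: (back i (j - i)%N) => //; rewrite subnKC //; lia.
exists n0.+1, N; split; last by case=> // i; apply: zcst.
have := zP n0.+1; rewrite !zcst ?leqW //; nia.
Qed.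
End FloorRecurrence.

(** * Planar vectors and matrices, and their embedding in the rationals *)

Lemma cv2_entries (R : Type) (v : 'cV[R]_2) : v = cv2 (v ord0 ord0) (v ord_max ord0).
Proof.
apply/colP=> i; rewrite mxE; case: eqP => [-> //|/eqP i0].
by congr (v _ ord0); apply/val_inj; case: i i0 => [[|[|]]].
Qed.

Lemma cv2_inj (R : Type) (x y x' y' : R) : cv2 x y = cv2 x' y' -> x = x' /\ y = y'.
Proof.
by move=> /colP e; have := e ord0; have := e ord_max; rewrite !mxE.
Qed.

Lemma mul_mx2_cv2 (R : pzSemiRingType) (a b c d x y : R) :
  mx2 a b c d *m cv2 x y = cv2 (a * x + b * y) (c * x + d * y).
Proof.
apply/colP=> i; rewrite mxE !big_ord_recl big_ord0 !mxE addr0.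
by case: (i == ord0).
Qed.

Lemma cv2D (R : pzSemiRingType) (x y x' y' : R) :
  cv2 x y + cv2 x' y' = cv2 (x + x') (y + y').
Proof. by apply/colP=> i; rewrite !mxE; case: (i == ord0). Qed.

Lemma cv2N (R : pzRingType) (x y : R) : - cv2 x y = cv2 (- x) (- y).
Proof. by apply/colP=> i; rewrite !mxE; case: (i == ord0). Qed.

Lemma scale_cv2 (R : pzSemiRingType) (k x y : R) :
  k *: cv2 x y = cv2 (k * x) (k * y).
Proof. by apply/colP=> i; rewrite !mxE; case: (i == ord0). Qed.

Lemma det_mx2 (R : comPzRingType) (a b c d : R) :
  \det (mx2 a b c d) = a * d - b * c.
Proof.
rewrite (expand_det_row _ ord0) !big_ord_recl big_ord0 /cofactor !det_mx11 !mxE /=.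
by rewrite addr0 expr0 expr1; ring.
Qed.

Lemma ratmx_cv2 (x y : int) : ratmx (cv2 x y) = cv2 x%:~R y%:~R.
Proof. by apply/colP=> i; rewrite !mxE; case: (i == ord0). Qed.

Lemma ratmx_mx2 (a b c d : int) :
  ratmx (mx2 a b c d) = mx2 a%:~R b%:~R c%:~R d%:~R.
Proof.
by apply/matrixP=> i j; rewrite !mxE; case: (i == ord0); case: (j == ord0).
Qed.

Lemma ratmxD (m n : nat) (M N : 'M[int]_(m, n)) : ratmx (M + N) = ratmx M + ratmx N.
Proof. exact: map_mxD. Qed.

Lemma ratmxM (m n q : nat) (M : 'M[int]_(m, n)) (N : 'M[int]_(n, q)) :
  ratmx (M *m N) = ratmx M *m ratmx N.
Proof. exact: map_mxM. Qed.

Lemma ratmxZ (m n : nat) (c : int) (M : 'M[int]_(m, n)) :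
  ratmx (c *: M) = c%:~R *: ratmx M.
Proof. exact: map_mxZ. Qed.

Lemma ratmx_inj (m n : nat) : injective (@ratmx m n).
Proof.
move=> M N /matrixP MN; apply/matrixP=> i j.
by have := MN i j; rewrite !mxE => /intr_inj.
Qed.

(** * Layers of the digit module and their denominators *)

(** Horner form of the sums of [k] terms: it isolates the integral term, which is what one step of
    the dynamics removes. *)
Fixpoint Z2adj_layer (T : 'M[rat]_2) (k : nat) : set 'cV[rat]_2 :=
  if k is k'.+1 then
    [set v | exists u y, Z2adj_layer T k' y /\ v = ratmx u + T *m y]
  else [set 0].

Lemma Z2adj_layerE (T : 'M[rat]_2) (k : nat) :
  Z2adj_layer T k =
  [set \sum_(i < k) T ^+ i *m ratmx (u i) | u in [set: 'I_k -> 'cV[int]_2]].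
Proof.
elim: k => [|k IHk] /=.
  apply/seteqP; split=> [_ ->|_ [u _ <-]] /=; last by rewrite big_ord0.
  by exists (fun=> 0) => //; rewrite big_ord0.
have shift (u : 'I_k.+1 -> 'cV[int]_2) :
    \sum_(i < k.+1) T ^+ i *m ratmx (u i) =
    ratmx (u ord0) + T *m \sum_(i < k) T ^+ i *m ratmx (u (lift ord0 i)).
  rewrite big_ord_recl expr0 mul1mx mulmx_sumr; congr (_ + _).
  by apply: eq_bigr => i _; rewrite exprS mulmxA.
rewrite IHk; apply/seteqP; split=> [_ [v [_ [[u _ <-] ->]]]|_ [u _ <-]].
  exists (fun i => if unlift ord0 i is Some j then u j else v) => //.
  rewrite shift unlift_none; congr (_ + _ *m _).
  by apply: eq_bigr => i _; rewrite liftK.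
exists (u ord0), (\sum_(i < k) T ^+ i *m ratmx (u (lift ord0 i))).
by split; [exists (u \o lift ord0)|rewrite shift].
Qed.

Lemma Z2adjP (T : 'M[rat]_2) (x : 'cV[rat]_2) :
  Z2adj T x <-> exists k, Z2adj_layer T k.+1 x.
Proof.
split=> [[[//|k] _ xk]|[k xk]]; first by exists k; rewrite Z2adj_layerE.
by exists k.+1 => //; rewrite -Z2adj_layerE.
Qed.

Lemma Z2adj_layerD (T : 'M[rat]_2) (k : nat) (u : 'cV[int]_2) (y : 'cV[rat]_2) :
  Z2adj_layer T k.+1 y -> Z2adj_layer T k.+1 (ratmx u + y).
Proof.
by move=> [v [z [zk ->]]]; exists (u + v), z; split; rewrite // ratmxD addrA.
Qed.

Lemma Z2adj_layer1 (T : 'M[rat]_2) (x : 'cV[rat]_2) :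
  Z2adj_layer T 1 x <-> exists u, x = ratmx u.
Proof.
split=> [[u [_ [-> ->]]]|[u ->]]; first by exists u; rewrite mulmx0 addr0.
by exists u, 0; split; rewrite // mulmx0 addr0.
Qed.

Lemma Z2adj_int (T : 'M[rat]_2) (u : 'cV[int]_2) : Z2adj T (ratmx u).
Proof. by apply/Z2adjP; exists 0%N; apply/Z2adj_layer1; exists u. Qed.

(** [\det Q] times [Q^-1 P] is the integer matrix [\adj Q *m P], so each layer costs at most one
    factor [\det Q]. *)
Lemma digit_module_denom (P Q : 'M[int]_2) (y : 'cV[rat]_2) :
  ratmx Q \in unitmx -> digit_module P Q y ->
  exists k v, (\det Q ^+ k)%:~R *: y = ratmx v.
Proof.
move=> Q_unit /Z2adjP[k]; move: {k}k.+1 => k yk; exists k.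
elim: k y yk => [|k IHk] y /=; first by move=> ->; exists 0; rewrite scaler0 /ratmx map_mx0.
move=> [u [z [/IHk[v zv] ->]]].
have QT : (\det Q)%:~R *: (invmx (ratmx Q) *m ratmx P) = ratmx (\adj Q *m P).
  rewrite ratmxM /ratmx map_mx_adj -det_map_mx scalemxAl /invmx Q_unit scalerA.
  by rewrite divff ?scale1r // -unitfE -unitmxE.
exists (\det Q ^+ k.+1 *: u + (\adj Q *m P) *m v).
rewrite scalerDr ratmxD ratmxZ ratmxM -zv -QT; congr (_ + _).
by rewrite -scalemxAr -scalemxAl scalerA -intrM -exprSr.
Qed.

(** * Uniqueness of digits *)

Section Digits.
Variables (P Q : 'M[int]_2) (a b eps d : int).
Hypotheses (P_form : P = mx2 a b eps d) (eps_pm1 : eps = 1 \/ eps = -1).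
Hypotheses (P_unit : ratmx P \in unitmx) (Q_unit : ratmx Q \in unitmx).
Hypothesis det_coprime : coprimez (\det P) (\det Q).
Local Notation p := `|\det P|%N.
Local Notation D := (collinear_digits p).
Local Notation Phi := (digit_map P Q D).

(** Clearing denominators gives an integral [h] with [P h = (q j, 0)], [q] a power of [\det Q]. As
    [eps] is a unit, the second row expresses [h] by its last entry; the first row then shows that
    [\det P] divides [q j], hence [j] by coprimality. *)
Lemma digit_module_dvd_det (y y' : 'cV[rat]_2) (j : int) :
  digit_module P Q y -> digit_module P Q y' ->
  ratmx P *m (y - y') = ratmx (cv2 j 0) -> (\det P %| j)%Z.
Proof.
move=> /(digit_module_denom Q_unit)[k [v yv]].
move=> /(digit_module_denom Q_unit)[k' [v' yv']] Pyj.
pose h := \det Q ^+ k' *: v - \det Q ^+ k *: v'.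
have hE : (\det Q ^+ (k + k'))%:~R *: (y - y') = ratmx h.
  rewrite /h /ratmx map_mxB -!/(ratmx _) !ratmxZ -yv -yv' !scalerA -!intrM -!exprD.
  by rewrite addnC scalerBr.
have Ph : P *m h = cv2 (\det Q ^+ (k + k') * j) 0.
  by apply: ratmx_inj; rewrite ratmxM -hE -scalemxAr Pyj -ratmxZ scale_cv2 mulr0.
rewrite -(@Gauss_dvdzr _ (\det Q ^+ (k + k'))); last exact: coprimezXr.
move: Ph; rewrite [h]cv2_entries P_form mul_mx2_cv2 => Ph.
have [e1 e2] := cv2_inj Ph.
apply/dvdzP; exists (- eps * h ord_max ord0); rewrite -e1 det_mx2.
have e3 : h ord0 ord0 = - eps * d * h ord_max ord0.
  by case: eps_pm1 => ee; move: e2; rewrite ee; lia.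
by rewrite e3; case: eps_pm1 => ->; ring.
Qed.

(** Evaluates [Phi] from any exhibited quotient and digit: two candidate digits differ by a multiple
    of [\det P] and both lie in [[0, p)]. *)
Lemma digit_mapE (x y : 'cV[rat]_2) (k : nat) :
  (k < p)%N -> digit_module P Q y ->
  ratmx Q *m x = ratmx P *m y + ratmx (cv2 k%:Z 0) -> Phi x = y.
Proof.
move=> kp yM Qx; rewrite /digit_map.
have -> : digit P Q D (ratmx Q *m x) = cv2 k%:Z 0.
  apply: xget_unique.
    by split; [exists k|exists y => //; rewrite Qx addrK].
  move=> _ [[k' /= k'p <-] [y' y'M Py']].
  have dvd := @digit_module_dvd_det y' y (k%:Z - k'%:Z) y'M yM.
  move: dvd; rewrite mulmxBr Py' Qx !ratmx_cv2 addrAC [_ + _ - _ *m _]addrAC subrr add0r.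
  rewrite cv2N cv2D subrr intrB => /(_ erefl) pkk'.
  suff -> : k' = k by [].
  have [q kk'] := dvdzP pkk'.
  have [q0|q0] := eqVneq q 0; first by move: kk'; rewrite q0; lia.
  have := congr1 absz kk'; rewrite abszM.
  by have : (1 <= `|q|)%N; [lia|nia].
by rewrite Qx addrK mulKmx.
Qed.

(** * The dynamics in integer coordinates *)

Section Dynamics.
Variables (r s del : int).
Hypotheses (Q_form : Q = mx2 r s 0 del) (del_pm1 : del = 1 \/ del = -1).
(** These are minus the trace and the determinant of [Q^-1 P], multiplied by [r]; note
    [del^-1 = del]. *)
Let m : int := - (a - s * eps * del + r * d * del).
Let n : int := del * \det P.
(* Coordinates with respect to the basis [(1, 0)], [(d / del, - eps / del)] of
   [Z^2], in which [digit_map] is a companion map up to the digit. *)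
Definition pt (u v : int) : 'cV[int]_2 := cv2 (u + v * d * del) (- (v * eps * del)).

Lemma pt_surj (w : 'cV[int]_2) : exists u v, w = pt u v.
Proof.
exists (w ord0 ord0 + eps * d * w ord_max ord0), (- (eps * del * w ord_max ord0)).
rewrite {1}[w]cv2_entries /pt.
by case: eps_pm1 del_pm1 => -> [] ->; congr cv2; ring.
Qed.

(** The basis is chosen so that [Q e1 = r e1], [P f = n e1] and [Q f + P e1 = - m e1]; thus [v'] is
    free and affects only the digit. *)
Lemma mulQ_pt (u v v' : int) :
  Q *m pt u v = P *m pt (- v) v' + cv2 (r * u - m * v - n * v') 0.
Proof.
rewrite Q_form P_form !mul_mx2_cv2 cv2D /n P_form det_mx2 /m.
by case: eps_pm1 del_pm1 => -> [] ->; congr cv2; ring.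
Qed.


Lemma digit_exists (u v : int) :
  exists v', 0 <= r * u - m * v - n * v' < p%:Z.
Proof.
have n_neq0 : n != 0.
  move: P_unit; rewrite unitmxE unitfE /ratmx det_map_mx intr_eq0 /n.
  by case: del_pm1 => ->; lia.
have absn : `|n|%N = p by rewrite /n; case: del_pm1 => ->; lia.
exists ((r * u - m * v) %/ n)%Z.
have := divz_eq (r * u - m * v) n; have := modz_ge0 (r * u - m * v) n_neq0.
by have := ltz_mod (r * u - m * v) n_neq0; rewrite -abszE absn; lia.
Qed.

(** As [Q] cancels against [Q^-1 P], the tail [y] of a Horner form loses one power of [Q^-1 P]. *)
Lemma digit_map_pt (u v v' : int) (y : 'cV[rat]_2) :
  0 <= r * u - m * v - n * v' < p%:Z -> digit_module P Q (ratmx (pt (- v) v') + y) ->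
  Phi (ratmx (pt u v) + invmx (ratmx Q) *m ratmx P *m y) = ratmx (pt (- v) v') + y.
Proof.
move=> /andP[k_ge0 k_ltp] yM.
apply: (@digit_mapE _ _ `|(r * u - m * v - n * v')%R|%N) => //.
  by lia.
rewrite mulmxDr -mulmxA mulKVmx // -ratmxM (mulQ_pt u v v') ratmxD ratmxM.
by rewrite gez0_abs // mulmxDr addrAC.
Qed.

Lemma digit_map_int (u v v' : int) :
  0 <= r * u - m * v - n * v' < p%:Z -> Phi (ratmx (pt u v)) = ratmx (pt (- v) v').
Proof.
move=> kv'; have := @digit_map_pt u v v' 0 kv'.
by rewrite mulmx0 !addr0; apply; exact: Z2adj_int.
Qed.

(** Induction on layers: the integral term left by a step is absorbed into the first term of the
    tail. *)
Lemma orbit_integral (x : 'cV[rat]_2) :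
  digit_module P Q x -> exists i u v, iter i Phi x = ratmx (pt u v).
Proof.
move=> /Z2adjP[k]; elim: k x => [|k IHk] x.
  by move=> /Z2adj_layer1[w ->]; have [u [v ->]] := pt_surj w; exists 0%N, u, v.
move=> [w [y [yk ->]]]; have [u [v ->]] := pt_surj w.
have [v' kv'] := digit_exists u v.
have yk' := Z2adj_layerD (pt (- v) v') yk.
have [i [u1 [v1 e]]] := IHk _ yk'.
exists i.+1, u1, v1; rewrite iterSr (digit_map_pt kv') //.
by apply/Z2adjP; exists k.
Qed.

(** A step moves the second coordinate, negated, to the first, so a single sequence codes the orbit;
    its recurrence says that the digits lie in [[0, p)]. *)
Lemma orbit_recurrence (u v : int) :
  exists2 z : nat -> int,
    forall i, 0 <= - (n * z i.+2 + m * z i.+1 + r * z i) < p%:Z &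
    forall i, iter i Phi (ratmx (pt u v)) = ratmx (pt (- z i) (z i.+1)).
Proof.
pose nxt (uv : int * int) : int * int := (- uv.2, xchoose (digit_exists uv.1 uv.2)).
pose z i := - (iter i nxt (u, v)).1.
have z1 i : (iter i nxt (u, v)).2 = z i.+1 by rewrite /z iterS /= opprK.
have zP i : 0 <= - (n * z i.+2 + m * z i.+1 + r * z i) < p%:Z.
  have -> : z i.+2 = (nxt (iter i nxt (u, v))).2 by rewrite -z1.
  rewrite -z1 /z /=; case: (iter i nxt (u, v)) => u' v' /=.
  by have := xchooseP (digit_exists u' v'); move: (xchoose _) => w; lia.
exists z => //; elim=> [|i IHi]; first by rewrite -z1 /z /= opprK.
rewrite iterS IHi (@digit_map_int _ _ (z i.+2)) //.
by have := zP i; lia.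
Qed.

End Dynamics.
End Digits.

(** * Attractors, periodic points and fixed points *)

Lemma attractor_periodic (T : Type) (X A : set T) (f : T -> T) (x : T) (k : nat) :
  is_attractor X f A -> X x -> iter k.+1 f x = x -> A x.
Proof.
move=> [_ [fA toA] _] Xx fkx; have [n An] := toA x Xx.
(* After the [n] steps that lead into [A], another [n * k] complete [n] periods and return to
   [x]. *)
have {1}-> : x = iter (n * k) f (iter n f x).
  rewrite -iterD addnC -mulnS; elim: n {An} => [//|n IHn].
  by rewrite mulSn addnC iterD fkx.
by elim: (n * k)%N => [//|j IHj]; apply: fA; exists (iter j f (iter n f x)).
Qed.

(** [B] lies in [A] because its points are periodic, and it is itself absorbing, so minimality of
    [A] gives equality. *)
Lemma attractor_fixed_points (T : Type) (X A B : set T) (f : T -> T) :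
  is_attractor X f A -> B `<=` X -> (forall x, B x -> f x = x) ->
  (forall x, X x -> exists n, B (iter n f x)) -> A = B.
Proof.
move=> attrA BX fB toB.
have BA : B `<=` A.
  by move=> x Bx; apply: (@attractor_periodic _ _ _ _ _ 0%N attrA); [exact: BX|exact: fB].
case: attrA => _ _ minA; apply: contrapT => AB; apply: (minA B).
  by rewrite properEneq; split=> //; apply/eqP => e; apply: AB.
by split=> // _ [x Bx <-]; rewrite fB.
Qed.

(** * Coefficients, eigenvalues and the constant [K] *)

Lemma char_poly2 (R : comNzRingType) (T : 'M[R]_2) (alpha beta : R) :
  char_poly T = 'X^2 + alpha *: 'X + beta%:P -> \tr T = - alpha /\ \det T = beta.
Proof.
move=> chi; have := char_poly_trace T isT; have := char_poly_det T.
rewrite chi !coefD !coefXn !coefZ !coefX !coefC /= sqrrN expr1n mul1r.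
by rewrite mulr0 mulr1 !add0r addr0 => -> ->; rewrite opprK.
Qed.

Lemma expanding_char_poly2 (T : 'M[rat]_2) (alpha beta : rat) (z : algC) :
  expanding T -> char_poly T = 'X^2 + alpha *: 'X + beta%:P ->
  z ^+ 2 + ratr alpha * z + ratr beta = 0 -> 1 < `|z|.
Proof.
move=> expT chi z0; apply: expT.
rewrite eigenvalue_root_char -map_char_poly chi !rmorphD /= map_polyXn map_polyZ.
by rewrite map_polyX map_polyC /root !hornerE z0.
Qed.

Lemma largest_nat_mul_le (p c : nat) (C : rat) :
  (0 < p)%N -> (0 < c)%N -> C = c%:R ->
  is_largest_nat [set k : nat | k%:R * C <= p%:R - 1] (p.-1 %/ c).
Proof.
move=> p_gt0 c_gt0 ->.
have E k : (k%:R * c%:R <= p%:R - 1 :> rat) = (k <= p.-1 %/ c)%N.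
  by rewrite leq_divRL // -natrM -{1}(prednK p_gt0) -natr1 addrK ler_nat.
by split=> /= [|k]; rewrite E.
Qed.

(** * The five coefficient ranges *)

Theorem theorem8 (P Q : 'M[int]_2) (a b d r s eps del : int)
  (alpha beta : rat) (p : nat) (A : set 'cV[rat]_2)
  (P_unit : ratmx P \in unitmx) (Q_unit : ratmx Q \in unitmx)
  (P_form : P = mx2 a b eps d) (Q_form : Q = mx2 r s 0 del)
  (r_gt0 : 0 < r)
  (eps_pm1 : eps = 1 \/ eps = -1) (del_pm1 : del = 1 \/ del = -1)
  (det_coprime : coprimez (\det P) (\det Q))
  (p_def : p = `|\det P|%N)
  (QP_expanding : expanding (invmx (ratmx Q) *m ratmx P))
  (chi_def : char_poly (invmx (ratmx Q) *m ratmx P)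
             = 'X^2 + alpha *: 'X + beta%:P)
  (A_attractor : digit_attractor P Q (collinear_digits p) A) :
  let w : 'cV[rat]_2 := cv2 (1 - d%:Q / del%:Q) (eps%:Q / del%:Q) in
  [/\ (* 1 *)
      0 <= alpha <= beta - 1 -> A = [set cv2 0 0],
      (* 2 *)
      1 < - alpha <= beta - 1 ->
      exists K : nat,
        is_largest_nat
          [set k : nat | k%:R * (p%:R + r%:Q * alpha + r%:Q) <= p%:R - 1] K /\
        A = [set l%:R *: w | l in [set l : nat | (l <= K)%N]],
      (* 3 *)
      0 < - alpha <= 1 /\ - alpha <= beta - 1 -> A = [set cv2 0 0],
      (* 4 *)
      0 < - alpha <= - beta - 1 ->
      [set cv2 0 0; cv2 (-1) 0; cv2 (d%:Q / del%:Q) (- (eps%:Q / del%:Q))]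
        `<=` A
    & (* 5 *)
      0 < alpha <= - beta - 1 ->
      exists K : nat,
        is_largest_nat
          [set k : nat | k%:R * (p%:R - r%:Q * alpha - r%:Q) <= p%:R - 1] K /\
        [set - (l%:R *: w) | l in [set l : nat | (l <= K)%N]] `<=` A].

Proof.
move=> w.
pose m : int := - (a - s * eps * del + r * d * del).
pose n : int := del * \det P.
have [trT detT] := char_poly2 chi_def.
have eigen := expanding_char_poly2 QP_expanding chi_def.
set T := invmx (ratmx Q) *m ratmx P in trT detT eigen.
have QT : ratmx Q *m T = ratmx P by rewrite mulKVmx.
(* The entries are read off [Q T = P] without inverting [Q]: the second row gives that of [T], the
   first then gives [r * t00]. *)
have rm : r%:Q * alpha = m%:~R.
  rewrite -[alpha]opprK -trT; clearbody T; move: QT.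
  rewrite Q_form P_form !ratmx_mx2 => /matrixP QT.
  have := QT ord_max ord_max; have := QT ord_max ord0; have := QT ord0 ord0.
  rewrite /mxtrace !mxE !big_ord_recl !big_ord0 !mxE /= !mul0r !add0r !addr0.
  rewrite (_ : lift ord0 ord0 = ord_max); last exact: val_inj.
  move: (T ord0 ord0) (T ord_max ord_max) (T ord_max ord0) => t00 t11 t10.
  rewrite /m !(intrN, intrD, intrM); move: del_pm1 => [] -> e00 e10 e11.
    have -> : t11 = d%:~R by lra.
    have t10E : t10 = eps%:~R by lra.
    by move: e00; rewrite t10E; lra.
  have -> : t11 = - d%:~R by lra.
  have t10E : t10 = - eps%:~R by lra.
  by move: e00; rewrite t10E; lra.
have rn : r%:Q * beta = n%:~R.
  have := congr1 determinant QT; rewrite det_mulmx detT /ratmx !det_map_mx.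
  rewrite /n Q_form det_mx2 mulr0 subr0 !intrM => <-.
  by case: del_pm1 => ->; rewrite ?intrN; ring.
have r_gt0Q : 0 < r%:Q by rewrite ltr0z.
have n_neq0 : n != 0.
  move: P_unit; rewrite unitmxE unitfE /ratmx det_map_mx intr_eq0 /n.
  by case: del_pm1 => ->; lia.
have n_abs : `|n|%N = p by rewrite p_def /n; case: del_pm1 => ->; lia.
have p_gt0 : (0 < p)%N by lia.
have delV : (del%:Q)^-1 = del%:Q by case: del_pm1 => ->.
(* Multiples of [w] have coordinates [(l, - l)]; they are fixed when the digit [l * (n + m + r)] is
   admissible. *)
have ptE l : ratmx (pt eps d del l (- l)) = l%:~R *: w.
  rewrite /w /pt ratmx_cv2 scale_cv2 delV.
  by congr cv2; rewrite !(intrD, intrM, intrN); ring.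
have step := digit_map_int P_form eps_pm1 P_unit Q_unit det_coprime Q_form del_pm1.
have orbit := orbit_recurrence P_form eps_pm1 P_unit Q_unit det_coprime Q_form del_pm1.
have integral := orbit_integral P_form eps_pm1 P_unit Q_unit det_coprime Q_form del_pm1.
move: step orbit integral; rewrite -/m -/n -p_def => step orbit integral.
set Phi := digit_map P Q _ in step orbit integral.
have {orbit} orbit x : digit_module P Q x -> exists i (z : nat -> int),
    (forall k, 0 <= - (n * z k.+2 + m * z k.+1 + r * z k) < p%:Z) /\
    (forall k, iter (k + i) Phi x = ratmx (pt eps d del (- z k) (z k.+1))).
  move=> /integral[i [u [v xi]]]; have [z zP zE] := orbit u v.
  by exists i, z; split=> // k; rewrite iterD xi.
have fixed l : 0 <= l * (n + m + r) < p%:Z -> Phi (l%:~R *: w) = l%:~R *: w.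
  by rewrite -ptE => lP; rewrite (step _ _ (- l)) ?opprK //; lia.
have wM l : digit_module P Q (l%:~R *: w) by rewrite -ptE; apply: Z2adj_int.
have w0 : cv2 0 0 = 0%:~R *: w by rewrite /w scale_cv2 !mulr0z !mul0r.
have fixedA l : 0 <= l * (n + m + r) < p%:Z -> A (l%:~R *: w).
  by move=> /fixed lw; apply: (attractor_periodic A_attractor (k := 0%N)).
(* Cases 2 and 3 share this description; in case 3 it has [K = 0]. *)
have case23 : 0 < - alpha <= beta - 1 -> exists K : nat,
      is_largest_nat
        [set k : nat | k%:R * (p%:R + r%:Q * alpha + r%:Q) <= p%:R - 1] K /\
      A = [set l%:R *: w | l in [set l : nat | (l <= K)%N]].
  move=> /andP[al_gt al_le].
  have m_lt0 : m < 0 by rewrite -(ltrz0 rat) -rm pmulr_rlt0 // -oppr_gt0.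
  have mrn : r - m <= n by rewrite -(ler_int rat) intrB -rm -rn; nra.
  have np : n = p%:Z by lia.
  pose c := `|(p%:Z + m + r)%R|%N.
  have cE : c%:Z = p%:Z + m + r by rewrite /c; lia.
  have c_gt0 : (0 < c)%N by lia.
  exists (p.-1 %/ c)%N; split.
    apply: largest_nat_mul_le => //.
    by rewrite rm [RHS]pmulrn cE !intrD.
  apply: (attractor_fixed_points A_attractor) => [_ [l _ <-]|_ [l /= lK <-]|x xM].
  + by rewrite pmulrn.
  + rewrite pmulrn; apply: fixed; rewrite np -cE.
    by move: lK; rewrite leq_divRL //; lia.
  have [i [z [zP zE]]] := orbit x xM.
  have [||||k [l [[l_ge0 lp] zk]]] := @floor_recurrence_constant p%:Z m r z => //.
  + by lia.
  + by move: zP; rewrite np.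
  exists (k + i)%N; rewrite zE !zk // opprK ptE.
  exists `|l|%N; last by rewrite pmulrn gez0_abs.
  by rewrite /= leq_divRL // -lez_nat; lia.
split.
- move=> /andP[al_ge0 al_le].
  have m_ge0 : 0 <= m by rewrite -(ler0z rat) -rm mulr_ge0 // ltW.
  have mrn : m + r <= n by rewrite -(ler_int rat) intrD -rm -rn; nra.
  have np : n = p%:Z by lia.
  (* If [r = p], then the characteristic polynomial is [x^2 + 1], whose root ['i] has modulus 1,
     against expansion. *)
  have r_lt : r < p%:Z.
    rewrite lt_neqAle; apply/andP; split; last by lia.
    apply/eqP => rp; have m0 : m = 0 by lia.
    have al0 : alpha = 0.
      by move: rm; rewrite m0 => /eqP; rewrite mulf_eq0 gt_eqF //= => /eqP.
    have be1 : beta = 1.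
      apply: (mulfI (lt0r_neq0 r_gt0Q)); rewrite rn mulr1 np rp //.
    have := eigen 'i; rewrite al0 be1 rmorph0 rmorph1 mul0r addr0 sqrCi addNr.
    by rewrite normCi ltxx => /(_ erefl).
  apply: (attractor_fixed_points A_attractor) => [x -> /=|x -> /=|x xM].
  + by rewrite w0.
  + by rewrite w0; apply: fixed; rewrite mul0r.
  have [i [z [zP zE]]] := orbit x xM.
  have [|||||k zk] := @floor_recurrence_vanish p%:Z m r z => //; [by lia|by move: zP; rewrite np|].
  by exists (k + i)%N; rewrite zE !zk // oppr0 w0 -ptE oppr0.
- by move=> /andP[al_gt al_le]; apply: case23; lra.
- move=> [/andP[al_gt al_le] al_le']; have [|K [[KP _] ->]] := case23; first by lra.
  (* Here [m + r = r * (alpha + 1)] is nonnegative, so the coefficient of [K] is at least [p]. *)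
  have K0 : K = 0%N.
    move: KP; rewrite /=; case: K => // K; rewrite -natr1 rm => KP; exfalso.
    have : 0 <= (m + r)%:~R :> rat by rewrite intrD -rm; nra.
    have : 0 <= K%:R :> rat by [].
    have : 0 < p%:R :> rat by rewrite ltr0n.
    by move: KP; rewrite intrD; nra.
  rewrite K0; apply/seteqP; split=> [_ [l /= + <-]|_ ->].
    by rewrite leqn0 => /eqP ->; rewrite scale0r w0 scale0r.
  by exists 0%N => //; rewrite w0.
- move=> /andP[al_gt al_le].
  have m_lt0 : m < 0 by rewrite -(ltrz0 rat) -rm pmulr_rlt0 //; lra.
  have mrn : r - m <= - n.
    by rewrite -(ler_int rat) intrB intrN -rm -rn; nra.
  have e1E : cv2 (-1) 0 = ratmx (pt eps d del (-1) 0).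
    by rewrite /pt ratmx_cv2 !mul0r addr0 oppr0 intrN.
  have fE : cv2 (d%:Q / del%:Q) (- (eps%:Q / del%:Q)) = ratmx (pt eps d del 0 1).
    by rewrite /pt ratmx_cv2 !mul1r add0r delV intrN !intrM.
  (* [- e1] and [f] form a 2-cycle with digits [- r - n] and [- m], both in [[0, p)] because
     [n = - p]. *)
  have e1f : Phi (ratmx (pt eps d del (-1) 0)) = ratmx (pt eps d del 0 1).
    by rewrite (step _ _ 1) ?oppr0 //; lia.
  have fe1 : Phi (ratmx (pt eps d del 0 1)) = ratmx (pt eps d del (-1) 0).
    by rewrite (step _ _ 0) //; lia.
  move=> _ [[->|->]|->].
  + by rewrite w0; apply: fixedA; lia.
  + rewrite e1E; apply: (attractor_periodic A_attractor (k := 1%N)); first exact: Z2adj_int.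
    by rewrite -[LHS]/(Phi (Phi _)) e1f fe1.
  rewrite fE; apply: (attractor_periodic A_attractor (k := 1%N)); first exact: Z2adj_int.
  by rewrite -[LHS]/(Phi (Phi _)) fe1 e1f.
move=> /andP[al_gt al_le].
have m_gt0 : 0 < m by rewrite -(ltr0z rat) -rm mulr_gt0.
have mrn : m + r <= - n.
  by rewrite -(ler_int rat) intrD intrN -rm -rn; nra.
(* Equality would make 1 a root of the characteristic polynomial, against expansion; so [c] below is
   positive and [K] exists. *)
have mrn' : m + r != - n.
  apply/eqP => mrn_eq.
  have chi1 : 1 + alpha + beta = 0.
    apply: (mulfI (lt0r_neq0 r_gt0Q)).
    rewrite mulr0 !mulrDr rm rn mulr1 -!intrD (_ : r + m + n = 0) //; lia.
  suff : 1 < `|1 : algC| by rewrite normr1 ltxx.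
  apply: eigen; rewrite expr1n mulr1.
  by rewrite -(rmorph1 (ratr : rat -> algC)) -!rmorphD chi1 rmorph0.
pose c := `|(p%:Z - m - r)%R|%N.
have cE : c%:Z = p%:Z - m - r by rewrite /c; lia.
have c_gt0 : (0 < c)%N by lia.
exists (p.-1 %/ c)%N; split.
  apply: largest_nat_mul_le => //.
  by rewrite rm [RHS]pmulrn cE !intrB.
(* Since [n = - p], the point [- l w] has digit [l * c]. *)
move=> _ [l /= lK <-]; rewrite pmulrn -scaleNr -intrN.
apply: fixedA.
by move: lK; rewrite leq_divRL //; nia.
Qed.
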